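(* Let $m>n$ and let $\Sigma$ be an $n$-dimensional complete (without boundary) self-shrinker properly immersed in $\mathbb{R}^m$. Let $k\in\{m-n,\ldots,m-2\}$, $p=m-k-1$ and $R=\sqrt{2(n-p)}$. If $\Sigma$ is inside the closed cylinder $\overline{B^{k+1}(R)}\times\mathbb{R}^p\subset\mathbb{R}^m$, then $\Sigma\subset S^k(R)\times\mathbb{R}^p$.
   Context: An $n$-dimensional submanifold $\Sigma$ immersed in $\mathbb{R}^m$, $m>n$, is called a self-shrinker if $\mathbf{H}=-\frac12 X^N$, where $X$ is the position vector, $X^N$ is the component of $X$ normal to $\Sigma$, and $\mathbf{H}=\sum_{i=1}^n(\nabla_{E_i}E_i)^N$ is the mean curvature vector ($\{E_i\}$ a local orthonormal tangent frame of $\Sigma$, $\nabla$ the Euclidean connection), i.e. the trace of the second fundamental form. Inclusions of $\Sigma$ in subsets of $\mathbb{R}^m$ refer to the image of the immersion. Notation: $B^{k+1}(R)\subset\mathbb{R}^{k+1}$ is the (open) ball of radius $R$ centered at the origin, $\overline{A}$ is the closure of $A$, $S^k(R)\subset\mathbb{R}^{k+1}$ is the $k$-dimensional sphere of radius $R$ centered at the origin, and $\mathbb{R}^m=\mathbb{R}^{k+1}\times\mathbb{R}^p$. *)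

(* Defs.v *)
(* Points of R^d are row vectors 'rV[R]_d.  The library norm `|_| on 'rV[R]_d is the
   sup norm; it is used only through the topology it induces, and all metric notions
   go through the Euclidean inner product [dot] below. *)
From HB Require Import structures.
From mathcomp Require Import all_boot all_order all_algebra.
From mathcomp Require Import all_classical all_reals all_analysis.
Import Order.TTheory GRing.Theory Num.Theory.
Import numFieldNormedType.Exports.
Set Implicit Arguments.
Unset Strict Implicit.
Unset Printing Implicit Defensive.
Local Open Scope classical_set_scope.
Local Open Scope ring_scope.

Section Euclidean.
Context {R : realType}.

Definition dot d (u v : 'rV[R]_d) : R := \sum_(i < d) u 0 i * v 0 i.

Definition enorm d (u : 'rV[R]_d) : R := Num.sqrt (dot u u).

(* B^d(r), the open Euclidean ball in R^d. *)
Definition eball d (r : R) : set 'rV[R]_d := [set u | enorm u < r].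

(* S^(d-1)(r), the Euclidean sphere in R^d. *)
Definition esphere d (r : R) : set 'rV[R]_d := [set u | enorm u = r].

(* A x R^p, inside R^(d + p) = R^d x R^p. *)
Definition cylinder d p (A : set 'rV[R]_d) : set 'rV[R]_(d + p) :=
  [set row_mx a b | a in A & b in setT].

End Euclidean.

Section Smoothness.
Context {R : realType}.

(* Class C^j, meant for open U. *)
Fixpoint Ck_on (V W : normedModType R) (j : nat) (U : set V) (f : V -> W) : Prop :=
  match j with
  | 0 => forall x, U x -> {for x, continuous f}
  | j'.+1 => (forall x, U x -> differentiable f x) /\
             (forall v : V, Ck_on j' U ('D_v f))
  end.

Definition smooth_on (V W : normedModType R) (U : set V) (f : V -> W) : Prop :=
  forall j, Ck_on j U f.

End Smoothness.

(* [coords] and [param] are mutually inverse homeomorphisms between the open sets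
   [dom] and [img]; they are total functions whose values elsewhere are
   irrelevant. *)
Record chart (R : realType) (n : nat) (M : topologicalType) := Chart {
  dom : set M;
  img : set 'rV[R]_n;
  coords : M -> 'rV[R]_n;
  param : 'rV[R]_n -> M;
  dom_open : open dom;
  img_open : open img;
  coords_img : forall x, dom x -> img (coords x);
  param_dom : forall u, img u -> dom (param u);
  coordsK : forall x, dom x -> param (coords x) = x;
  paramK : forall u, img u -> coords (param u) = u;
  coords_continuous_on : forall x, dom x -> {for x, continuous coords};
  param_continuous_on : forall u, img u -> {for u, continuous param} }.

(* A C^oo structure of dimension n, without boundary, on M. *)
Record smooth_manifold (R : realType) (n : nat) (M : topologicalType) :=
  SmoothManifold {
  manifold_hausdorff : hausdorff_space M;
  manifold_second_countable : @second_countable M;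
  atlas : set (chart R n M);
  atlas_cover : forall x, exists2 c, atlas c & dom c x;
  atlas_compatible : forall c d, atlas c -> atlas d ->
    smooth_on (img c `&` param c @^-1` dom d) (coords d \o param c) }.

Section Submanifold.
Context {R : realType} {n m : nat} {M : topologicalType}.
Implicit Types (S : smooth_manifold R n M) (X : M -> 'rV[R]_m).

Definition immersion S X : Prop :=
  forall c, atlas S c ->
    smooth_on (img c) (X \o param c) /\
    (forall u, img c u -> injective ('d (X \o param c) u)).

Definition proper_map X : Prop :=
  forall K : set 'rV[R]_m, compact K -> compact (X @^-1` K).

Section Local.
(* F is the immersion read in a chart. The rows of the Jacobian matrix 'J F u
   span the tangent space, and its orthogonal complement is the row space of
   kermx ('J F u)^T. *)
Variables (F : 'rV[R]_n -> 'rV[R]_m) (U : set 'rV[R]_n).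

Definition normal_part (u : 'rV[R]_n) (v : 'rV[R]_m) : 'rV[R]_m :=
  v *m proj_mx (kermx ('J F u)^T) <<'J F u>>%MS.

(* The vector field of R^m along F with components e in the coordinates. *)
Definition push (e : 'rV[R]_n -> 'rV[R]_n) : 'rV[R]_n -> 'rV[R]_m :=
  fun w => 'D_(e w) F w.

(* The tangent fields E_i = push (e i) form an orthonormal frame on U. *)
Definition orthonormal_frame (e : 'I_n -> 'rV[R]_n -> 'rV[R]_n) : Prop :=
  (forall i, smooth_on U (e i)) /\
  (forall w, U w ->
     forall i j, dot (push (e i) w) (push (e j) w) = (i == j)%:R).

End Local.

(* H is the mean curvature vector of F at u: sum_i (nabla_{E_i} E_i)^N for a
   local orthonormal tangent frame E_i = push F (e i) near u; the Euclidean
   derivative nabla_{E_i} differentiates E_i in the coordinate direction e i u.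
   The value of the sum does not depend on the frame. *)
Definition is_mean_curvature (F : 'rV[R]_n -> 'rV[R]_m) (u : 'rV[R]_n)
    (H : 'rV[R]_m) : Prop :=
  exists (U : set 'rV[R]_n) (e : 'I_n -> 'rV[R]_n -> 'rV[R]_n),
    [/\ open U, U u, orthonormal_frame F U e &
        H = \sum_(i < n) normal_part F u ('D_(e i u) (push F (e i)) u)].

Definition self_shrinker S X : Prop :=
  forall c, atlas S c -> forall u, img c u ->
    is_mean_curvature (X \o param c) u
      (- (2^-1 *: normal_part (X \o param c) u (X (param c u)))).

(* Curves are parametrized by the whole line and used on [0, 1]. A piecewise
   C^1 path on [0, 1] becomes such a curve, with the same length, after a
   reparametrization that stops at the endpoints and at the corners. *)
Definition C1_curve S (g : R -> M) : Prop :=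
  continuous g /\
  (forall c, atlas S c ->
     Ck_on (V := R^o) 1 (g @^-1` dom c) (coords c \o g)).

(* Length for the Riemannian metric induced by the immersion X. *)
Definition curve_length X (g : R -> M) : \bar R :=
  (\int[lebesgue_measure]_(t in `[0%R, 1%R]) (enorm (derive1 (X \o g) t))%:E)%E.

(* Riemannian distance; it is +oo between distinct connected components. *)
Definition riem_dist S X (x y : M) : \bar R :=
  ereal_inf [set curve_length X g | g in
               [set g | [/\ C1_curve S g, g 0 = x & g 1 = y]]].

Definition complete_immersion S X : Prop :=
  forall s : nat -> M,
    (forall eps : R, 0 < eps -> exists N, forall i j, (N <= i)%N -> (N <= j)%N ->
       (riem_dist S X (s i) (s j) < eps%:E)%E) ->
    exists x, forall eps : R, 0 < eps -> exists N, forall i, (N <= i)%N ->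
       (riem_dist S X (s i) x < eps%:E)%E.

End Submanifold.

(* Main.v *)
Require Import Defs.
From HB Require Import structures.
From mathcomp Require Import all_boot all_order all_algebra.
From mathcomp Require Import all_classical all_reals all_analysis.
From mathcomp Require Import ring lra.
Import Order.TTheory GRing.Theory Num.Theory.
Import numFieldNormedType.Exports.
Set Implicit Arguments.
Unset Strict Implicit.
Unset Printing Implicit Defensive.
Local Open Scope classical_set_scope.
Local Open Scope ring_scope.

(** The proof applies maximum principles to the drift Laplacian
    L = Delta - <X, grad> / 2 of the immersion X. The self-shrinker equation says
    that each coordinate of X satisfies L X_a = - X_a / 2
    ([shrinker_frame_exists]); hence L |X|^2 = 2 n - |X|^2.
    Write X = (Y, Z) in R^(k+1) x R^p. The gradients of the p coordinates of Z
    have total squared length at most p, so those of Y have at least n - p, and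
    L |Y|^2 >= 2 (n - p) - |Y|^2 = R^2 - |Y|^2. Therefore w = R^2 - |Y|^2, which
    is nonnegative by hypothesis, satisfies L w <= - w <= 0
    ([shrinker_laplacian_ball]), and it has to be shown that w = 0.

    First, the zero set of w is open: this is Hopf's strong maximum principle,
    proved in a chart ([zero_set_open]). If w does not vanish identically near
    one of its zeros, there is a ball inside the set where w > 0 that touches
    the zero set at a point u1. The balls are those of F *m T, where F is the
    immersion in the chart and T a matrix making F *m T a local diffeomorphism
    of R^n. The barrier ([hopf_barrier]) is then a polynomial in X, on which L
    is explicit and locally bounded, although the frames defining L are chosen
    point by point.

    So the set B where w > 0 is both open and closed. If it is not empty, then
    for every eps > 0 the proper function w + eps |X|^2 has a minimum on B.
    There 0 <= L (w + eps |X|^2) <= - w + eps (2 n - |X|^2), so that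
    |X|^2 <= 2 n and w <= 2 n eps ([positive_small_point]). As the part of B
    where |X|^2 <= 2 n is compact, w has a positive minimum on it, which
    contradicts the choice of a small eps ([gap_eq0]).

    All second-order calculus is done along lines, by one-dimensional jets: the
    value of L at a point only requires the restrictions of a function to
    finitely many lines through that point ([drift_jet]). *)

(** * Two-jets along lines and the second-derivative test *)

Section Jets.
Context {R : realType} {V : normedModType R}.
Implicit Types (f g : V -> R) (u v : V) (a d : R).

Lemma near_line (P : V -> Prop) u v : (\forall w \near u, P w) ->
  \forall t \near (0 : R), P (t *: v + u).
Proof.
have cl : (fun s : R => s *: v + u) @ (0 : R) --> u.
  rewrite -[X in _ --> X]add0r -[X in _ --> X + _](scale0r v).
  by apply: cvgD; [apply: cvgZr_tmp; exact: cvg_id|exact: cvg_cst].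
by move=> nP; exact: (cl _ nP).
Qed.

(** Restricting to the line through [u] with direction [v] keeps the calculus
    one-dimensional: [a] and [d] are the first two derivatives at [u] of the
    restriction. *)
Definition line_jet f u v a d : Prop :=
  exists2 f' : R -> R,
    (\forall t \near (0 : R), is_derive (t : R) (1 : R) (fun s : R => f (s *: v + u)) (f' t))
      /\ f' 0 = a
    & is_derive (0 : R) (1 : R) f' d.

Lemma line_jet_cst (c : R) u v : line_jet (fun=> c) u v 0 0.
Proof.
exists (fun=> 0); last exact: is_derive_cst.
by split => //; near=> t; exact: is_derive_cst.
Unshelve. all: by end_near. Qed.

Lemma line_jetD f g u v a d a' d' : line_jet f u v a d ->
  line_jet g u v a' d' -> line_jet (fun w => f w + g w) u v (a + a') (d + d').
Proof.
move=> [f' [nf f0] df] [g' [ng g0] dg]; exists (fun t => f' t + g' t).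
  split; last by rewrite f0 g0.
  by near=> t; apply: is_deriveD; near: t.
exact: is_deriveD.
Unshelve. all: by end_near. Qed.

Lemma line_jetM f g u v a d a' d' : line_jet f u v a d ->
  line_jet g u v a' d' ->
  line_jet (fun w => f w * g w) u v (f u * a' + g u * a)
    (f u * d' + g u * d + 2 * (a * a')).
Proof.
move=> [f' [nf f0] df] [g' [ng g0] dg].
pose F (s : R) := f (s *: v + u); pose G (s : R) := g (s *: v + u).
exists (F * g' + G * f').
  split; last by rewrite -f0 -g0 /F /G !fctE scale0r add0r.
  by near=> t; apply: is_deriveM; near: t.
have dF : is_derive (0 : R) 1 F (f' 0) by exact: (nbhs_singleton nf).
have dG : is_derive (0 : R) 1 G (g' 0) by exact: (nbhs_singleton ng).
apply: is_derive_eq.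
rewrite /F /G /= scale0r add0r f0 g0 /GRing.scale /=; ring.
Unshelve. all: by end_near. Qed.

(** The second-derivative test: were [d] negative, the derivative would be
    negative just after 0, and [f] would decrease below its minimum there. *)
Lemma line_jet_min f u v a d : line_jet f u v a d ->
  (\forall w \near u, f u <= f w) -> a = 0 /\ 0 <= d.
Proof.
move=> [f' [nf f0] df] fmin.
pose F (s : R) := f (s *: v + u).
have F0 : F 0 = f u by rewrite /F scale0r add0r.
have Fmin : \forall s \near (0 : R), F 0 <= F s.
  by rewrite F0; exact: (near_line v fmin).
have [e /= e0 He] : exists2 e : R, 0 < e & forall s, `|s| < e ->
    F 0 <= F s /\ is_derive s 1 F (f' s).
  have /nbhs_ballP[e /= e0 He] : \forall s \near (0 : R),
     F 0 <= F s /\ is_derive s 1 F (f' s).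
    by near=> s; split; near: s.
  by exists e => // s se; apply: He; rewrite /ball /= sub0r normrN.
have dF0 : is_derive (0 : R) 1 F 0.
  apply: (@derive1_at_min _ F (- e) e).
  - lra.
  - by move=> t; rewrite in_itv /= -ltr_norml => /He[_ []].
  - by rewrite in_itv /= oppr_lt0 e0.
  - by move=> t; rewrite in_itv /= -ltr_norml => /He[].
have a0 : a = 0.
  have [|_ [_ F'0]] := He 0; first by rewrite normr0.
  by have [_] := dF0; rewrite F'0 f0.
split => //; rewrite leNgt; apply/negP => d0.
have [df1 df2] := df.
have neg : \forall h \near (0 : R)^', h^-1 * f' h < 0.
  move/cvgrPdist_lt : df1 => /(_ (- d)); rewrite oppr_gt0 => /(_ d0) near_d.
  near=> h.
  have : `|'D_1 f' (0 : R) - h^-1 *: ((f' \o shift 0) (h *: 1) - f' 0)| < - d.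
    by near: h; exact: near_d.
  rewrite df2 f0 a0 /= addr0 subr0 [h *: 1]mulr1 /GRing.scale /= => /ltr_normlP[].
  lra.
have [r /= r0 Hr] : exists2 r : R, 0 < r &
    forall x, `|x| < r -> x != 0 -> x^-1 * f' x < 0.
  move: neg => /nbhs_ballP[r /= r0 Hr]; exists r => // x xr x0.
  by apply: Hr => //; rewrite /ball /= sub0r normrN.
near (0 : R)^'+ => h.
have h0 : 0 < h by [].
have hr : h < r by near: h; exact: nbhs_right_lt.
have negh x : 0 < x -> x <= h -> f' x < 0.
  move=> x0 xh; rewrite -(pmulr_rlt0 _ (x := x^-1)) ?invr_gt0//.
  by apply: Hr; [rewrite gtr0_norm // (le_lt_trans xh)|rewrite gt_eqF].
have he : h < e by near: h; exact: nbhs_right_lt.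
have [c] : exists2 c, c \in `]0, h[%R & F h - F 0 = f' c * (h - 0).
  apply: MVT => //.
    move=> x; rewrite in_itv /= => /andP[x0 xh].
    by apply: (He x _).2; rewrite gtr0_norm // (lt_trans xh).
  apply: continuous_in_subspaceT => x; rewrite inE /= in_itv /= => /andP[x0 xh].
  apply: differentiable_continuous; apply/derivable1_diffP.
  have xe : `|x| < e by rewrite ger0_norm // (le_lt_trans xh).
  by have [_ []] := He x xe.
rewrite in_itv /= subr0 => /andP[c0 ch] E.
have Fh : F 0 <= F h by apply: (He h _).1; rewrite gtr0_norm.
have := negh c c0 (ltW ch).
by rewrite -(pmulr_llt0 _ h0) -E subr_lt0 ltNge Fh.
Unshelve. all: by end_near. Qed.

End Jets.

(** * Drift Laplacians, orthonormal frames and squared distances *)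

Section DriftJets.
Context {R : realType} {V : normedModType R} {n : nat}.
Variables (u : V) (e : 'I_n -> V) (b : V).
Implicit Types (f g : V -> R) (a : 'I_n -> R) (l : R).

(** At [u], the diffusion operator with second-order part along the vectors
    [e i] and drift [b], that is L f = sum_i D_(e i) D_(e i) f + D_b f, takes
    the value [l] on [f], and [a i] is the derivative of [f] along [e i].
    Keeping the [a i] makes the operator computable on products. *)
Definition drift_jet f a l : Prop :=
  exists (d : 'I_n -> R) (a0 d0 : R),
    [/\ forall i, line_jet f u (e i) (a i) (d i),
        line_jet f u b a0 d0
      & l = \sum_(i < n) d i + a0].

Lemma drift_jet_cst (c : R) : drift_jet (fun=> c) (fun=> 0) 0.
Proof.
exists (fun=> 0), 0, 0; split=> [i||].
- exact: line_jet_cst.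
- exact: line_jet_cst.
- by rewrite big1_eq addr0.
Qed.

Lemma drift_jetD f g a l a' l' : drift_jet f a l -> drift_jet g a' l' ->
  drift_jet (fun w => f w + g w) (fun i => a i + a' i) (l + l').
Proof.
move=> [d [a0 [d0 [jf jf0 ->]]]] [d' [a0' [d0' [jg jg0 ->]]]].
exists (fun i => d i + d' i), (a0 + a0'), (d0 + d0'); split.
- by move=> i; exact: line_jetD.
- exact: line_jetD.
- by rewrite big_split /=; ring.
Qed.

(** L (f g) = f L g + g L f + 2 <grad f, grad g>. *)
Lemma drift_jetM f g a l a' l' : drift_jet f a l -> drift_jet g a' l' ->
  drift_jet (fun w => f w * g w) (fun i => f u * a' i + g u * a i)
    (f u * l' + g u * l + 2 * \sum_(i < n) a i * a' i).
Proof.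
move=> [d [a0 [d0 [jf jf0 ->]]]] [d' [a0' [d0' [jg jg0 ->]]]].
exists (fun i => f u * d' i + g u * d i + 2 * (a i * a' i)),
  (f u * a0' + g u * a0), (f u * d0' + g u * d0 + 2 * (a0 * a0')); split.
- by move=> i; exact: line_jetM.
- exact: line_jetM.
- by rewrite !big_split /= -!mulr_sumr; ring.
Qed.

Lemma drift_jetZ (c : R) f a l : drift_jet f a l ->
  drift_jet (fun w => c * f w) (fun i => c * a i) (c * l).
Proof.
move=> jf; have := drift_jetM (drift_jet_cst c) jf.
under [X in 2 * X]eq_bigr do rewrite mul0r.
rewrite big1_eq !(mulr0, addr0).
by congr drift_jet; apply/funext => i; rewrite addr0.
Qed.

Lemma drift_jet_sum (I : Type) (s : seq I) (f : I -> V -> R)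
    (a : I -> 'I_n -> R) (l : I -> R) :
  (forall c, drift_jet (f c) (a c) (l c)) ->
  drift_jet (fun w => \sum_(c <- s) f c w) (fun i => \sum_(c <- s) a c i)
    (\sum_(c <- s) l c).
Proof.
move=> jf; elim: s => [|c s ih].
  rewrite big_nil; have := drift_jet_cst 0.
  by congr drift_jet; apply/funext => i; rewrite big_nil.
rewrite big_cons; have := drift_jetD (jf c) ih.
by congr drift_jet; apply/funext => i; rewrite big_cons.
Qed.

Lemma drift_jet_min f a l : drift_jet f a l ->
  (\forall w \near u, f u <= f w) -> 0 <= l.
Proof.
move=> [d [a0 [d0 [jf jf0 ->]]]] fmin.
have [-> _] := line_jet_min jf0 fmin.
rewrite addr0; apply: sumr_ge0 => i _.
exact: (line_jet_min (jf i) fmin).2.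
Qed.

End DriftJets.
Arguments drift_jet {R V n}.

Section EuclideanAlgebra.
Context {R : realType}.

Lemma dotE d (x y : 'rV[R]_d) : dot x y = (x *m y^T) 0 0.
Proof. by rewrite !mxE; apply: eq_bigr => i _; rewrite mxE. Qed.

Lemma dot_ge0 d (x : 'rV[R]_d) : 0 <= dot x x.
Proof. by apply: sumr_ge0 => i _; rewrite -expr2 sqr_ge0. Qed.

Lemma dotC d (x y : 'rV[R]_d) : dot x y = dot y x.
Proof. by apply: eq_bigr => i _; rewrite mulrC. Qed.

Lemma dot_eq0 d (x : 'rV[R]_d) : dot x x = 0 -> x = 0.
Proof.
move=> /eqP; rewrite psumr_eq0; last by move=> i _; rewrite -expr2 sqr_ge0.
move=> /allP h; apply/rowP => i; rewrite mxE; apply/eqP.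
by have := h i (mem_index_enum i); rewrite mulf_eq0 orbb.
Qed.

Lemma dot_cauchy_schwarz d (x y : 'rV[R]_d) :
  dot x y ^+ 2 <= dot x x * dot y y.
Proof.
have [y0|y0] := eqVneq (dot y y) 0.
  rewrite y0 mulr0 (dot_eq0 y0) /dot big1 ?expr0n //= => i _.
  by rewrite mxE mulr0.
have ypos : 0 < dot y y by rewrite lt_def y0 dot_ge0.
have := dot_ge0 (dot y y *: x - dot x y *: y).
have -> : dot (dot y y *: x - dot x y *: y) (dot y y *: x - dot x y *: y) =
    dot y y * (dot x x * dot y y - dot x y ^+ 2).
  have sq A B : dot (A *: x - B *: y) (A *: x - B *: y) =
      A ^+ 2 * dot x x - 2 * (A * B) * dot x y + B ^+ 2 * dot y y.
    rewrite /dot !mulr_sumr -sumrN -!big_split /=.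
    by apply: eq_bigr => i _; rewrite !mxE; ring.
  by rewrite sq; ring.
by rewrite pmulr_rge0 // subr_ge0.
Qed.

(** The square of the Frobenius norm. *)
Definition frob m d (A : 'M[R]_(m, d)) : R := \tr (A *m A^T).

Lemma frobE m d (A : 'M[R]_(m, d)) : frob A = \sum_(i < m) \sum_(j < d) A i j ^+ 2.
Proof.
apply: eq_bigr => i _; rewrite !mxE; apply: eq_bigr => j _.
by rewrite mxE expr2.
Qed.

Lemma frob_ge0 m d (A : 'M[R]_(m, d)) : 0 <= frob A.
Proof.
by rewrite frobE; apply: sumr_ge0 => i _; apply: sumr_ge0 => j _; exact: sqr_ge0.
Qed.

(** Bessel's inequality for each column of [T]: [E^T *m E] is the orthogonal
    projection onto the span of the rows of [E]. *)
Lemma frob_bessel n m d (E : 'M[R]_(n, m)) (T : 'M[R]_(m, d)) :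
  E *m E^T = 1%:M -> frob (E *m T) <= frob T.
Proof.
move=> EE; rewrite -subr_ge0.
have -> : frob T - frob (E *m T) = frob (T - E^T *m (E *m T)).
  rewrite /frob mxtrace_mulC [X in _ - X]mxtrace_mulC [RHS]mxtrace_mulC -raddfB.
  have -> : (T - E^T *m (E *m T))^T = T^T - (E *m T)^T *m E.
    by rewrite linearB /= trmx_mul trmxK.
  congr (\tr _); rewrite mulmxBl !mulmxBr.
  rewrite -[X in _ = _ - (_ - X)]mulmxA (mulmxA E) EE mul1mx.
  rewrite [X in _ = _ - X](_ : _ = 0) ?subr0 ?mulmxA ?trmx_mul //.
  exact: subrr.
exact: frob_ge0.
Qed.

End EuclideanAlgebra.

Section SelfShrinkerFrames.
Context {R : realType} {V : normedModType R} {n m : nat}.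
Implicit Types (F : V -> 'rV[R]_m) (u : V).

(** The only form in which the self-shrinker equation is used. The rows of [E]
    are an orthonormal tangent frame, the images of the vectors [e i], and the
    drift Laplacian L = Delta - <X, grad> / 2 read in the coordinates of the
    chart has second-order part [e] and drift [b]. The equation H = - X^N / 2 says
    exactly that L X = - X / 2. *)
Definition shrinker_frame F u (e : 'I_n -> V) (b : V) (E : 'M[R]_(n, m)) : Prop :=
  [/\ E *m E^T = 1%:M,
      forall a, drift_jet u e b (fun w => F w 0 a) (E^~ a) (- (2^-1 * F u 0 a))
    & forall v, exists c : 'rV[R]_n, 'D_v F u = c *m E].

(** All the test functions of the proof are built from these squared distances
    of a linear image of the immersion to a point. *)
Definition sqdist d F (T : 'M[R]_(m, d)) (q : 'rV[R]_d) (w : V) : R :=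
  dot (F w *m T - q) (F w *m T - q).

(** Since L X = - X / 2, the value of L on a quadratic function of X involves
    neither the drift nor the second derivatives of the immersion: that is why
    it can be bounded locally without controlling them. *)
Lemma drift_jet_sqdist d F u e b E (T : 'M[R]_(m, d)) q :
  shrinker_frame F u e b E ->
  drift_jet u e b (sqdist F T q)
    (fun i => 2 * dot (F u *m T - q) (row i (E *m T)))
    (2 * frob (E *m T) - dot (F u *m T - q) (F u *m T)).
Proof.
move=> [_ jF _].
have jc (c : 'I_d) : drift_jet u e b (fun w => (F w *m T - q) 0 c)
    (fun i => (E *m T) i c) (- (2^-1 * (F u *m T) 0 c)).
  have := drift_jet_sum (index_enum 'I_m) (fun a => drift_jetZ (T a c) (jF a)).
  move=> /drift_jetD/(_ (drift_jet_cst u e b (- q 0 c))).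
  congr drift_jet.
  - apply/funext => w; rewrite !mxE; congr (_ + _).
    by apply: eq_bigr => a _; rewrite mulrC.
  - apply/funext => i; rewrite addr0 mxE.
    by apply: eq_bigr => a _; rewrite mulrC.
  - rewrite addr0 mxE mulr_sumr -sumrN; apply: eq_bigr => a _; ring.
have := drift_jet_sum (index_enum 'I_d) (fun c => drift_jetM (jc c) (jc c)).
congr drift_jet.
- apply/funext => i; rewrite /dot mulr_sumr; apply: eq_bigr => c _.
  by rewrite [row _ _ _ _]mxE; ring.
- have -> : frob (E *m T) =
      \sum_(c < d) \sum_(i < n) (E *m T) i c * (E *m T) i c.
    rewrite frobE exchange_big /=.
    by apply: eq_bigr => c _; apply: eq_bigr => i _; rewrite expr2.
  rewrite /dot mulr_sumr -sumrN -big_split /=.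
  by apply: eq_bigr => c _; field.
Qed.

(** A lower bound for the gradient of a squared distance which does not mention
    the frame: the derivative along a fixed [v] is a component of the gradient.
    This uniformity matters because the frames are chosen point by point,
    without any continuity. *)
Lemma frame_gradient_bound d F u e b E (T : 'M[R]_(m, d)) q v :
  shrinker_frame F u e b E ->
  4 * dot (F u *m T - q) ('D_v F u *m T) ^+ 2 <=
  dot ('D_v F u) ('D_v F u) *
    \sum_(i < n) (2 * dot (F u *m T - q) (row i (E *m T))) ^+ 2.
Proof.
move=> [EE _ /(_ v)[c ->]].
set x := F u *m T - q; pose g : 'rV[R]_n := x *m (E *m T)^T.
have gE i : dot x (row i (E *m T)) = g 0 i.
  by rewrite !mxE; apply: eq_bigr => j _; rewrite !mxE.
under eq_bigr do rewrite gE exprMn.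
rewrite -mulr_sumr.
have -> : \sum_(i < n) g 0 i ^+ 2 = dot g g.
  by apply: eq_bigr => i _; rewrite expr2.
have -> : dot (c *m E) (c *m E) = dot c c.
  by rewrite !dotE trmx_mul mulmxA -(mulmxA c) EE mulmx1.
have -> : dot x (c *m E *m T) = dot c g.
  by rewrite dotC !dotE /g trmx_mul trmxK -!mulmxA.
have := dot_cauchy_schwarz c g; lra.
Qed.

End SelfShrinkerFrames.

(** * The self-shrinker equation in a chart *)

Section CoordinateDerivatives.
Context {R : realType}.

Lemma is_derive_entry (V : normedModType R) m (G : V -> 'rV[R]_m) u v a :
  derivable G u v -> is_derive u v (fun w => G w 0 a) ('D_v G u 0 a).
Proof.
move=> dG; split; first exact: (derivable_mxP _ _ _).1.
by rewrite derive_mx // mxE.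
Qed.

Lemma is_derive_line (V : normedModType R) (g : V -> R) u v (t : R) :
  derivable g (t *: v + u) v ->
  is_derive (t : R) (1 : R) (fun s : R => g (s *: v + u)) ('D_v g (t *: v + u)).
Proof.
move=> dg.
have E : (fun h : R => h^-1 *:
    (((fun s : R => g (s *: v + u)) \o shift t) (h *: 1) - g (t *: v + u))) =
  (fun h : R => h^-1 *: ((g \o shift (t *: v + u)) (h *: v) - g (t *: v + u))).
  apply/funext => h /=; congr (_ *: (g _ - _)).
  by rewrite addrA -scalerDl [h *: 1]mulr1.
by split; rewrite /derivable /derive E.
Qed.

Lemma line_jet_entry (V : normedModType R) m (G : V -> 'rV[R]_m) u v a :
  (\forall w \near u, differentiable G w) -> derivable ('D_v G) u v ->
  line_jet (fun w => G w 0 a) u v ('D_v G u 0 a) ('D_v ('D_v G) u 0 a).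
Proof.
move=> dG ddG; exists (fun t => 'D_v G (t *: v + u) 0 a).
  split; last by rewrite scale0r add0r.
  near=> t.
  have dGt : differentiable G (t *: v + u) 
    by near: t; exact: (near_line v dG).
  have D := is_derive_entry a (diff_derivable (v := v) dGt).
  by have [d <-] := D; exact: is_derive_line d.
have D := is_derive_entry a ddG.
have [d <-] := D.
have := @is_derive_line _ (fun w => 'D_v G w 0 a) u v 0.
by rewrite scale0r add0r => /(_ d).
Unshelve. all: by end_near.
Qed.

End CoordinateDerivatives.

Section FrameFromMeanCurvature.
Context {R : realType} {n m : nat}.
Variables (F : 'rV[R]_n -> 'rV[R]_m) (u : 'rV[R]_n).
Hypothesis dF : \forall w \near u, differentiable F w.
Hypothesis ddF : forall v, differentiable ('D_v F) u.

Lemma derive_row_sum w (c : 'rV[R]_n) : differentiable F w ->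
  'D_c F w = \sum_(j < n) c 0 j *: 'D_(delta_mx 0 j) F w.
Proof.
move=> dFw; rewrite deriveE // [c in LHS]row_sum_delta linear_sum /=.
by apply: eq_bigr => j _; rewrite linearZ /= deriveE.
Qed.

Lemma derive_push_entry (e : 'rV[R]_n -> 'rV[R]_n) v a : differentiable e u ->
  'D_v (push F e) u 0 a =
  \sum_(j < n) (e u 0 j * 'D_v ('D_(delta_mx 0 j) F) u 0 a +
                'D_(delta_mx 0 j) F u 0 a * 'D_v e u 0 j).
Proof.
move=> de.
pose S a' : 'rV[R]_n -> R :=
  \sum_(j < n) ((fun w => e w 0 j) * (fun w => 'D_(delta_mx 0 j) F w 0 a')).
have near_push a' : \forall w \near u, S a' w = push F e w 0 a'.
  near=> w; rewrite /push derive_row_sum; last by near: w.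
  rewrite /S fct_sumE summxE; apply: eq_bigr => j _.
  by rewrite [in RHS]mxE.
have dS a' : is_derive u v (S a')
    (\sum_(j < n) (e u 0 j * 'D_v ('D_(delta_mx 0 j) F) u 0 a' +
                   'D_(delta_mx 0 j) F u 0 a' * 'D_v e u 0 j)).
  apply: is_derive_sum => j.
  apply: is_deriveM; apply: is_derive_entry; exact: diff_derivable.
have dP a' : is_derive u v (fun w => push F e w 0 a')
    (\sum_(j < n) (e u 0 j * 'D_v ('D_(delta_mx 0 j) F) u 0 a' +
                   'D_(delta_mx 0 j) F u 0 a' * 'D_v e u 0 j)).
  exact: near_eq_is_derive (dS a').
rewrite derive_mx; first by rewrite mxE; have [_ ->] := dP a.
by apply/derivable_mxP => i j; rewrite (ord1 i); have [] := dP j.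
Unshelve. all: by end_near. Qed.

(** Differentiating a tangent field along the immersion gives the Hessian term
    plus a tangent vector, so the normal part only sees the Hessian. *)
Lemma derive_push (e : 'rV[R]_n -> 'rV[R]_n) v : differentiable e u ->
  'D_v (push F e) u = 'D_v ('D_(e u) F) u + 'D_('D_v e u) F u.
Proof.
move=> de; apply/rowP => a; rewrite derive_push_entry //.
have E : 'D_v ('D_(e u) F) u 0 a =
    \sum_(j < n) (e u 0 j * 'D_v ('D_(delta_mx 0 j) F) u 0 a + 0).
  rewrite [LHS](@derive_push_entry (cst (e u))); last exact: differentiable_cst.
  by apply: eq_bigr => j _; rewrite derive_cst mxE mulr0.
have addE (x y : 'rV[R]_m) : (x + y) 0 a = x 0 a + y 0 a by rewrite mxE.
rewrite [RHS]addE [X in _ = X + _]E.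
rewrite derive_row_sum; last exact: nbhs_singleton dF.
rewrite summxE -big_split /=; apply: eq_bigr => j _.
by rewrite mxE addr0 mulrC [X in _ + X = _]mulrC.
Qed.

(** The kernel of the transposed Jacobian and the row space of the Jacobian are
    orthogonal and of complementary dimensions. *)
Lemma normal_part_eq0 x : normal_part F u x = 0 -> (x <= 'J F u)%MS.
Proof.
rewrite /normal_part; set J := 'J F u; set N := kermx _.
have NT : (N :&: <<J>> = 0)%MS.
  apply/eqP/rowV0P => v; rewrite sub_capmx genmxE => /andP[/sub_kermxP vN].
  move=> /submxP[c vc]; apply: dot_eq0.
  rewrite dotE {1}vc -mulmxA -[J in _ *m (J *m _)]trmxK -trmx_mul vN.
  by rewrite trmx0 mulmx0 mxE.
have xNT : (x <= N + <<J>>)%MS.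
  apply: submx_full; rewrite /row_full mxrank_disjoint_sum //.
  by rewrite mxrank_ker mxrank_gen mxrank_tr subnK // rank_leq_col.
move=> x0; have := add_proj_mx NT xNT; rewrite x0 add0r => <-.
by rewrite -(genmxE J); exact: proj_mx_sub.
Qed.

(** The self-shrinker equation says that sum_i D_(e i) D_(e i) F + F / 2 has no
    normal part; it is then the derivative of F along some vector, and the
    drift is its opposite. *)
Lemma shrinker_frame_exists :
  is_mean_curvature F u (- (2^-1 *: normal_part F u (F u))) ->
  exists (e : 'I_n -> 'rV[R]_n) (b : 'rV[R]_n) (E : 'M[R]_(n, m)),
    shrinker_frame F u e b E.
Proof.
move=> [U [e [oU Uu [se one]]] H].
have dFu : differentiable F u by exact: nbhs_singleton dF.
have de i : differentiable (e i) u by have [d _] := se i 1%N; exact: d.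
pose J := 'J F u; pose Em : 'M[R]_n := \matrix_(i, j) e i u 0 j.
have EmJ i : row i (Em *m J) = 'D_(e i u) F u.
  rewrite row_mul deriveEjacobian //; congr (_ *m _).
  by apply/rowP => j; rewrite !mxE.
have EE : (Em *m J) *m (Em *m J)^T = 1%:M.
  apply/matrixP => i j; rewrite [RHS]mxE -(one u Uu) /push -!EmJ /dot mxE.
  by apply: eq_bigr => a _; rewrite !mxE.
(* [y] holds the coordinates of the tangent vector [X]; the drift [b] removes
   from it the part due to the derivatives of the frame. *)
pose X : 'rV[R]_m := \sum_(i < n) 'D_(e i u) (push F (e i)) u + 2^-1 *: F u.
have /normal_part_eq0/submxP[y Xy] : normal_part F u X = 0.
  rewrite /normal_part mulmxDl mulmx_suml -scalemxAl -/(normal_part _ _ _).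
  by rewrite -[\sum_(i < n) _]H addNr.
pose b : 'rV[R]_n := \sum_(i < n) 'D_(e i u) (e i) u - y.
have XE : X = \sum_(i < n) 'D_(e i u) ('D_(e i u) F) u
    + (\sum_(i < n) 'D_(e i u) (e i) u) *m J + 2^-1 *: F u.
  have -> : X = \sum_(i < n) ('D_(e i u) ('D_(e i u) F) u +
      'D_(e i u) (e i) u *m J) + 2^-1 *: F u.
    congr (_ + _); apply: eq_bigr => i _.
    by rewrite [LHS]derive_push // [X in _ + X = _]deriveEjacobian.
  by rewrite big_split /= mulmx_suml.
have trace_eq : \sum_(i < n) 'D_(e i u) ('D_(e i u) F) u + 'D_b F u =
    - (2^-1 *: F u).
  rewrite [X in _ + X = _]deriveEjacobian // mulmxBl -/J -Xy XE.
  by rewrite addrA opprD addrA subrr add0r.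
have jF v a : line_jet (fun w => F w 0 a) u v ('D_v F u 0 a) ('D_v ('D_v F) u 0 a).
  exact: line_jet_entry dF (diff_derivable (ddF v)).
exists (fun i => e i u), b, (Em *m J); split=> //.
- move=> a; exists (fun i => 'D_(e i u) ('D_(e i u) F) u 0 a).
  exists ('D_b F u 0 a), ('D_b ('D_b F) u 0 a); split.
  + move=> i; have -> : (Em *m J) i a = 'D_(e i u) F u 0 a by rewrite -EmJ [RHS]mxE.
    exact: jF.
  + exact: jF.
  + have := congr1 (fun x : 'rV[R]_m => x 0 a) trace_eq.
    rewrite /= [X in X = _]mxE summxE => ->.
    by rewrite !mxE.
- move=> v; exists (v *m invmx Em); rewrite deriveEjacobian // mulmxA mulmxKV //.
  by have /mulmx1_unit[] : Em *m (J *m (Em *m J)^T) = 1%:M by rewrite mulmxA.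
Qed.

End FrameFromMeanCurvature.

(** * Compactness and continuity in row vectors *)

Section CompactMinima.
Context {R : realType} {T : topologicalType}.

(** Continuity of [f] is required at the points of [A] only, because the
    functions of interest are controlled on the domain of a chart and nowhere
    else. *)
Lemma compact_preimageI (A : set T) (f : T -> R) (C : set R) :
  compact A -> (forall x, A x -> {for x, continuous f}) -> closed C ->
  compact (A `&` f @^-1` C).
Proof.
move=> cA cf cC F FF FAC.
have [x [Ax Fx]] : A `&` cluster F !=set0.
  by apply: cA; apply: filterS FAC => y [].
exists x; split=> //; split=> //.
apply: cC => B fB; have [y [[_ Cy] By]] := Fx _ _ FAC (cf x Ax B fB).
by exists (f y).
Qed.

Lemma compact_min (A : set T) (f : T -> R) :
  A !=set0 -> compact A -> (forall x, A x -> {for x, continuous f}) ->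
  exists2 c, A c & forall x, A x -> f c <= f x.
Proof.
move=> A0 cA cf; have [|c cP minc] := compact_EVT_min A0 cA (f := f).
  by apply: continuous_in_subspaceT => x; rewrite inE => /cf.
by exists c; [rewrite inE in cP|move=> x Ax; apply: minc; rewrite inE].
Qed.

End CompactMinima.

Section RowVectorTopology.
Context {R : realType}.

Lemma entry_le_norm d (x : 'rV[R]_d) j : `|x 0 j| <= `|x|.
Proof.
by rewrite [leRHS]/Num.Def.normr /= mx_normrE; apply: (le_bigmax _ _ (0, j)).
Qed.

Lemma norm_le_entries d (x : 'rV[R]_d) (B : R) : 0 <= B ->
  (forall j, `|x 0 j| <= B) -> `|x| <= B.
Proof.
move=> B0 xB; rewrite [leLHS]/Num.Def.normr /= mx_normrE.
by apply: bigmax_le => // -[i j] _ /=; rewrite (ord1 i).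
Qed.

Lemma norm_le_dot d (x : 'rV[R]_d) (B : R) : 0 <= B ->
  dot x x <= B ^+ 2 -> `|x| <= B.
Proof.
move=> B0 xB; apply: norm_le_entries => // j.
rewrite -(@ler_pXn2r _ 2) ?nnegrE //; apply: le_trans xB.
rewrite real_normK ?num_real // /dot (bigD1 j) //= -expr2 lerDl.
by apply: sumr_ge0 => i _; rewrite -expr2 sqr_ge0.
Qed.

Lemma closed_box_compact d (x : 'rV[R]_d) (e : R) :
  compact (closed_ball_ Num.Def.normr x e).
Proof.
apply: bounded_closed_compact; last exact: closed_closed_ball_.
exists (`|x| + e); split; first exact: num_real.
move=> M xM y; rewrite /closed_ball_ /= => xye; apply: le_trans (ltW xM).
by rewrite -[y](subKr x) (le_trans (ler_normB _ _)) // lerD2l.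
Qed.

End RowVectorTopology.

Section EntrywiseContinuity.
Context {R : realType} {V : normedModType R}.
Variable u : V.

(** Continuity entry by entry, which passes through matrix products by the
    algebra of real-valued continuous functions. *)
Definition entries_continuous d (f : V -> 'rV[R]_d) : Prop :=
  forall j, {for u, continuous (fun w => f w 0 j)}.

Lemma near_le (f : V -> R) (z : R) :
  {for u, continuous f} -> f u < z -> \forall w \near u, f w <= z.
Proof. by move=> cf fz; near=> w; apply/ltW; near: w; exact: (cvgr_lt _ cf).
Unshelve. all: by end_near. Qed.

Lemma near_ge (f : V -> R) (z : R) :
  {for u, continuous f} -> z < f u -> \forall w \near u, z <= f w.
Proof. by move=> cf fz; near=> w; apply/ltW; near: w; exact: (cvgr_gt _ cf).
Unshelve. all: by end_near. Qed.

Lemma near_norm_le (f : V -> R) (z : R) :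
  {for u, continuous f} -> `|f u| < z -> \forall w \near u, `|f w| <= z.
Proof.
by move=> cf; apply: (near_le (f := fun w => `|f w|)); exact: cvg_norm.
Qed.

Lemma continuous_dist (x : V) : {for u, continuous (fun w => `|x - w|)}.
Proof.
have c : {for u, continuous (fun w => x - w)}.
  by apply: continuousB; [exact: cst_continuous|move=> A].
exact: (cvg_norm c).
Qed.

Lemma entries_continuous_of d (f : V -> 'rV[R]_d) :
  {for u, continuous f} -> entries_continuous f.
Proof.
move=> cf j; apply: (continuous_comp (g := fun x : 'rV[R]_d => x 0 j) cf).
exact: coord_continuous.
Qed.

Lemma continuous_sum_for (I : Type) (s : seq I) (f : I -> V -> R) :
  (forall i, {for u, continuous (f i)}) ->
  {for u, continuous (fun w => \sum_(i <- s) f i w)}.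
Proof.
move=> cf; elim: s => [|i s ih].
  have -> : (fun w => \sum_(i <- [::]) f i w) = (fun=> 0).
    by apply/funext => w; rewrite big_nil.
  exact: cst_continuous.
have -> : (fun w => \sum_(j <- i :: s) f j w) =
    (fun w => f i w + \sum_(j <- s) f j w).
  by apply/funext => w; rewrite big_cons.
by apply: continuousD; [exact: cf|exact: ih].
Qed.

Lemma entries_continuous_affine d d' (f : V -> 'rV[R]_d)
    (T : 'M[R]_(d, d')) (q : 'rV[R]_d') :
  entries_continuous f -> entries_continuous (fun w => f w *m T - q).
Proof.
move=> cf j.
have -> : (fun w => (f w *m T - q) 0 j) =
    (fun w => \sum_(a < d) f w 0 a * T a j + - q 0 j).
  by apply/funext => w; rewrite !mxE.
apply: continuousD; last exact: cst_continuous.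
apply: continuous_sum_for => a.
by apply: continuousM; [exact: cf|exact: cst_continuous].
Qed.

Lemma continuous_dot d (f g : V -> 'rV[R]_d) :
  entries_continuous f -> entries_continuous g ->
  {for u, continuous (fun w => dot (f w) (g w))}.
Proof.
by move=> cf cg; apply: continuous_sum_for => j; exact: continuousM.
Qed.

Lemma continuous_sqdist m d (F : V -> 'rV[R]_m) (T : 'M[R]_(m, d)) q :
  entries_continuous F -> {for u, continuous (sqdist F T q)}.
Proof.
by move=> cF; apply: continuous_dot; exact: entries_continuous_affine.
Qed.

End EntrywiseContinuity.

(** * A linear image of the immersion that is a local chart *)

Section LocalChart.
Context {R : realType} {n m : nat}.
Variables (F : 'rV[R]_n -> 'rV[R]_m) (U : set 'rV[R]_n).
Hypothesis oU : open U.
Hypothesis dF : forall u, U u -> differentiable F u.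
Hypothesis ddF : forall u, U u -> forall v, differentiable ('D_v F) u.

Lemma derive_entries_continuous u v : U u -> entries_continuous u ('D_v F).
Proof.
by move=> /ddF/(_ v)/differentiable_continuous; exact: entries_continuous_of.
Qed.

Lemma entries_continuousF u : U u -> entries_continuous u F.
Proof. by move=> /dF/differentiable_continuous; exact: entries_continuous_of. Qed.

Lemma near_box (u : 'rV[R]_n) (P : set 'rV[R]_n) : nbhs u P ->
  exists2 r : R, 0 < r & forall w : 'rV[R]_n, `|u - w| <= r -> P w.
Proof.
move=> /nbhs_ballP[r /= r0 rP]; exists (r / 2); first by rewrite divr_gt0.
move=> w uw; apply: rP; rewrite -ball_normE /ball_ /= (le_lt_trans uw) //.
by rewrite gtr_pMr // invf_lt1 // ltr1n.
Qed.

(** A left inverse [T] of the Jacobian at [u0] composed with the immersion gives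
    a map of R^n whose derivative stays close to the identity near [u0]. *)
Lemma local_straightening (u0 : 'rV[R]_n) : U u0 -> injective ('d F u0) ->
  exists (T : 'M[R]_(m, n)) (r : R), 0 < r /\ forall u : 'rV[R]_n, `|u0 - u| <= r ->
    U u /\ forall v, `|'D_v F u *m T - v| <= 2^-1 * `|v|.
Proof.
move=> Uu0 injF; pose J := 'J F u0.
have /row_freeP[T JT] : row_free J.
  rewrite -kermx_eq0; apply/eqP/row_matrixP => i; rewrite row0.
  apply: injF; rewrite linear0 -!deriveE ?deriveEjacobian; try exact: dF.
  by rewrite -row_mul mulmx_ker row0.
pose g j k u : R := `|('D_(delta_mx 0 j) F u *m T - delta_mx 0 j) 0 k|.
pose S u := \sum_(j < n) \sum_(k < n) g j k u.
have cS : {for u0, continuous S}.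
  apply: continuous_sum_for => j; apply: continuous_sum_for => k.
  have C : entries_continuous u0
      (fun w => 'D_(delta_mx 0 j) F w *m T - delta_mx 0 j).
    by apply: entries_continuous_affine; exact: derive_entries_continuous.
  exact: (cvg_norm (C k)).
have S0 : S u0 = 0.
  rewrite /S big1 // => j _; rewrite big1 // => k _.
  by rewrite /g deriveEjacobian; [rewrite -mulmxA JT mulmx1 subrr mxE normr0|exact: dF].
have [|r r0 rP] := @near_box u0 [set u | U u /\ S u < 2^-1].
  apply: filterI; first by apply: open_nbhs_nbhs; split.
  by apply: (cvgr_lt _ cS); rewrite S0 invr_gt0.
exists T, r; split=> // u /rP[Uu Su]; split=> // v.
have -> : 'D_v F u *m T - v =
    \sum_(j < n) v 0 j *: ('D_(delta_mx 0 j) F u *m T - delta_mx 0 j).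
  under eq_bigr do rewrite scalerBr.
  rewrite sumrB -row_sum_delta [in LHS]derive_row_sum; last exact: dF.
  by rewrite mulmx_suml; congr (_ - _); apply: eq_bigr => j _; rewrite scalemxAl.
apply: (@le_trans _ _ (S u * `|v|)); last by rewrite ler_wpM2r // ltW.
apply: le_trans (ler_norm_sum _ _ _) _.
rewrite mulr_suml; apply: ler_sum => j _.
rewrite normrZ mulrC; apply: ler_pM => //; last exact: entry_le_norm.
apply: norm_le_entries; first by apply: sumr_ge0 => k _; exact: normr_ge0.
move=> k; rewrite (bigD1 k) //= lerDl.
by apply: sumr_ge0 => i _; exact: normr_ge0.
Qed.

(** The derivative of [F *m T] minus the identity is at most 1/2 on a convex set,
    so the mean value theorem along a segment makes [F *m T] injective there,
    with a Lipschitz inverse. *)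
Lemma straightened_expansive (u0 : 'rV[R]_n) (T : 'M[R]_(m, n)) (r : R) :
  (forall u : 'rV[R]_n, `|u0 - u| <= r ->
    U u /\ forall v, `|'D_v F u *m T - v| <= 2^-1 * `|v|) ->
  forall u v : 'rV[R]_n, `|u0 - u| <= r -> `|u0 - v| <= r ->
  `|u - v| <= 2 * `|F u *m T - F v *m T|.
Proof.
move=> HT u v uK vK; pose x := u - v.
suff H : `|F u *m T - F v *m T - x| <= 2^-1 * `|x|.
  have : `|x| <= `|F u *m T - F v *m T| + 2^-1 * `|x|.
    rewrite -{1}(subKr (F u *m T - F v *m T) x).
    by rewrite (le_trans (ler_normB _ _)) // lerD2l.
  rewrite -/x; lra.
apply: norm_le_entries => [|c]; first by rewrite mulr_ge0 // invr_ge0.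
have segK t : 0 <= t <= 1 -> `|u0 - (t *: x + v)| <= r.
  move=> /andP[t0 t1].
  have -> : u0 - (t *: x + v) = t *: (u0 - u) + (1 - t) *: (u0 - v).
    by apply/rowP => i; rewrite !mxE; ring.
  rewrite (le_trans (ler_normD _ _)) // !normrZ ger0_norm // ger0_norm ?subr_ge0 //.
  have : t * `|u0 - u| <= t * r by rewrite ler_wpM2l.
  have : (1 - t) * `|u0 - v| <= (1 - t) * r by rewrite ler_wpM2l // subr_ge0.
  lra.
pose G w : R := \sum_(a < m) T a c * F w 0 a.
have GE w : (F w *m T) 0 c = G w.
  by rewrite mxE; apply: eq_bigr => a _; rewrite mulrC.
pose phi (t : R) : R := G (t *: x + v) - t * x 0 c.
pose dphi (t : R) : R := ('D_x F (t *: x + v) *m T - x) 0 c.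
have Dphi t : 0 <= t <= 1 -> is_derive (t : R) (1 : R) phi (dphi t).
  move=> t01; have [Uw _] := HT _ (segK t t01).
  have DG : is_derive (t *: x + v) x G (('D_x F (t *: x + v) *m T) 0 c).
    have Da a : is_derive (t *: x + v) x (fun w => F w 0 a)
        ('D_x F (t *: x + v) 0 a).
      by apply: is_derive_entry; apply: diff_derivable; exact: dF.
    have -> : G = \sum_(a < m) (T a c *: (fun w => F w 0 a)).
      by apply/funext => w; rewrite fct_sumE.
    apply: is_derive_eq.
    by rewrite mxE; apply: eq_bigr => a _; rewrite /GRing.scale /= mulrC.
  have [dG EG] := DG.
  have DL := is_derive_line dG; rewrite EG in DL.
  rewrite /dphi mxE [(- x) 0 c]mxE.
  apply: is_deriveB.
  have -> : (fun t : R => t * x 0 c) = x 0 c \*: id.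
    by apply/funext => s; rewrite /= mulrC.
  by apply: is_derive_eq; rewrite /GRing.scale /= mulr1.
have [z] : exists2 z, z \in `]0, 1[%R & phi 1 - phi 0 = dphi z * (1 - 0).
  apply: MVT => // [z|].
    by rewrite in_itv /= => /andP[z0 z1]; apply: Dphi; rewrite !ltW.
  apply: continuous_in_subspaceT => z; rewrite inE /= in_itv /= => z01.
  apply: differentiable_continuous; apply/derivable1_diffP.
  by have [] := Dphi z z01.
rewrite in_itv /= => /andP[z0 z1].
rewrite /phi scale1r scale0r add0r mul1r mul0r !subr0 mulr1 /x subrK -/x => E.
have -> : (F u *m T - F v *m T - x) 0 c = dphi z.
  have subE (a b : 'rV[R]_n) : (a - b) 0 c = a 0 c - b 0 c by rewrite !mxE.
  by rewrite -E (subE _ x) (subE (F u *m T)) !GE; ring.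
have [|_ /(_ x) b] := HT _ (segK z _); first by rewrite !ltW.
exact: le_trans (entry_le_norm _ _) b.
Qed.

End LocalChart.

(** * Hopf's barrier *)

Section StrongMaximumPrinciple.
Context {R : realType} {n m : nat}.
Variables (F : 'rV[R]_n -> 'rV[R]_m) (U : set 'rV[R]_n).
Hypothesis dF : forall u, U u -> differentiable F u.
Hypothesis ddF : forall u, U u -> forall v, differentiable ('D_v F) u.
Variables (u0 : 'rV[R]_n) (T : 'M[R]_(m, n)) (r : R).
Hypothesis straightT : forall u : 'rV[R]_n, `|u0 - u| <= r ->
  U u /\ forall v, `|'D_v F u *m T - v| <= 2^-1 * `|v|.
Local Notation G := (fun u => F u *m T).

Let U_in u : `|u0 - u| <= r -> U u.
Proof. by move=> /straightT[]. Qed.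

Lemma entries_continuousG u : U u -> entries_continuous u G.
Proof.
move=> Uu; have -> : G = (fun u => F u *m T - 0).
  by apply/funext => w; rewrite subr0.
by apply: entries_continuous_affine; exact: (entries_continuousF dF).
Qed.

Lemma sqdist_eq0 u y : `|u0 - u| <= r -> `|u0 - y| <= r ->
  sqdist F T (G y) u = 0 -> u = y.
Proof.
move=> uK yK /dot_eq0 E; apply/eqP; rewrite -subr_eq0 -normr_le0.
have := straightened_expansive dF straightT uK yK.
by rewrite E normr0 mulr0.
Qed.

(** Hopf's barrier, with a quadratic polynomial in [sigma] instead of the usual
    exponential. The function [sigma] is negative inside the ball of centre
    [G y] through [G u1], in the straightened picture. As its gradient does not
    vanish near [u1], a large [beta] makes the term - beta sigma^2 push L of the
    barrier below 0, while on a small box sigma - beta sigma^2 keeps the sign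
    of [sigma]; the last term makes the barrier positive at the points other
    than [u1] that are not inside that ball. *)
Lemma hopf_barrier (y u1 : 'rV[R]_n) : `|u0 - y| <= r -> `|u0 - u1| < r ->
  u1 != y ->
  let sigma u := sqdist F T (G y) u - sqdist F T (G y) u1 in
  exists beta rho : R, 0 < rho /\
    forall u, `|u1 - u| <= rho -> [/\ `|u0 - u| <= r, `|beta * sigma u| <= 2^-1 &
      forall e b (E : 'M[R]_(n, m)), shrinker_frame F u e b E ->
      exists2 al : ('I_n -> R) * R,
        drift_jet u e b (fun w => sigma w - beta * (sigma w * sigma w) +
          sqdist F T (G u1) w) al.1 al.2 & al.2 < 0].
Proof.
move=> yK u1K u1y sigma.
have u1K' := ltW u1K; have Uu1 := U_in u1K'.
pose q := G y; pose x1 := G u1 - q; pose p0 := dot x1 x1.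
have p0_gt0 : 0 < p0.
  rewrite lt_def dot_ge0 andbT; apply: contra_neq u1y; exact: sqdist_eq0.
(* The straightened Jacobian at [u1] is within 1/2 of the identity, hence
   invertible; so some [v] moves [G u1] straight away from [q], and the
   gradient of [sigma] does not vanish at [u1]. *)
have JT_unit : 'J F u1 *m T \in unitmx.
  rewrite -row_free_unit -kermx_eq0; apply/eqP/row_matrixP => i; rewrite row0.
  set k := row i _; have kJT : 'D_k F u1 *m T = 0.
    rewrite deriveEjacobian; last exact: dF.
    by rewrite -mulmxA -row_mul mulmx_ker row0.
  have [_ /(_ k)] := straightT u1K'.
  rewrite kJT sub0r normrN => k_le; apply/eqP; rewrite -normr_le0.
  by have := normr_ge0 k; move: k_le; lra.
pose v := x1 *m invmx ('J F u1 *m T).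
have vE : 'D_v F u1 *m T = x1.
  by rewrite deriveEjacobian ?mulmxKV //; [rewrite -mulmxA mulmxKV|exact: dF].
pose h u := dot (G u - q) ('D_v F u *m T).
pose M u := dot ('D_v F u) ('D_v F u).
pose A := M u1 + 1.
have A_gt0 : 0 < A by rewrite ltr_wpDl // dot_ge0.
pose D q' u := dot (G u - q') (G u).
pose C1 := `|D q u1| + 1.
pose C0 := 2 * frob T + C1.
(* [C0] bounds L of both squared distances and [kappa] bounds from below the
   squared gradient of [sigma], near [u1]. *)
pose kappa := p0 ^+ 2 / A.
have kappa_gt0 : 0 < kappa by rewrite divr_gt0 // exprn_gt0.
pose beta := (3 * C0 + 1) / (2 * kappa).
have betaE : 2 * beta * kappa = 3 * C0 + 1.
  by rewrite /beta; field; rewrite gt_eqF.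
have C0_ge0 : 0 <= C0.
  by rewrite /C0 /C1 addr_ge0 ?mulr_ge0 ?frob_ge0 // addr_ge0.
have beta_gt0 : 0 < beta.
  by apply: divr_gt0; [clear -C0_ge0; lra|exact: mulr_gt0].
have cD q' : {for u1, continuous (D q')}.
  apply: continuous_dot; last exact: entries_continuousG.
  by apply: entries_continuous_affine; exact: (entries_continuousF dF).
have c_h : {for u1, continuous h}.
  apply: continuous_dot.
    by apply: entries_continuous_affine; exact: (entries_continuousF dF).
  have -> : (fun w => 'D_v F w *m T) = (fun w => 'D_v F w *m T - 0).
    by apply/funext => w; rewrite subr0.
  by apply: entries_continuous_affine; exact: (derive_entries_continuous ddF).
have c_M : {for u1, continuous M}.
  by apply: continuous_dot; exact: (derive_entries_continuous ddF).
have c_s : {for u1, continuous (fun u => beta * sigma u)}.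
  apply: continuousM; first exact: cst_continuous.
  apply: continuousB; last exact: cst_continuous.
  by apply: continuous_sqdist; exact: (entries_continuousF dF).
have [rho rho0 Hrho] : exists2 rho : R, 0 < rho & forall u : 'rV[R]_n,
    `|u1 - u| <= rho ->
    [/\ `|u0 - u| <= r, `|beta * sigma u| <= 2^-1, `|D q u| <= C1,
        `|D (G u1) u| <= C1 & p0 / 2 <= h u /\ M u <= A].
  apply: near_box; near=> u; split.
  - near: u.
    apply/nbhs_ballP; exists (r - `|u0 - u1|); first by rewrite /= subr_gt0.
    move=> z; rewrite -ball_normE /ball_ /= => zu1.
    rewrite -[u0](subrK u1) -addrA (le_trans (ler_normD _ _)) //.
    by rewrite -lerBrDl ltW.
  - near: u; apply: near_norm_le c_s _.
    by rewrite /sigma subrr mulr0 normr0 invr_gt0.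
  - by near: u; apply: near_norm_le (cD q) _; rewrite ltrDl.
  - near: u; apply: near_norm_le (cD (G u1)) _.
    rewrite [X in X < _](_ : _ = 0) ?ltr_wpDl //.
    by rewrite /D subrr dotE mul0mx mxE normr0.
  split; near: u.
    apply: near_ge c_h _; rewrite /h vE -/x1 -/p0.
    by rewrite gtr_pMr // invf_lt1 // ltr1n.
  by apply: near_le c_M _; rewrite ltrDl.
exists beta, rho; split=> // u /Hrho[uK small_s D1 D2 [h_ge M_le]]; split=> //.
move=> e b E fr.
pose L q' := 2 * frob (E *m T) - D q' u.
pose a q' i := 2 * dot (G u - q') (row i (E *m T)).
have jet_at q' : drift_jet u e b (sqdist F T q') (a q') (L q').
  exact: drift_jet_sqdist fr.
have jet_sigma : drift_jet u e b sigma (a q) (L q).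
  have := drift_jetD (jet_at q) (drift_jet_cst u e b (- sqdist F T q u1)).
  by rewrite addr0; congr drift_jet; apply/funext => i; rewrite addr0.
have := drift_jetD (drift_jetD jet_sigma
  (drift_jetZ (- beta) (drift_jetM jet_sigma jet_sigma))) (jet_at (G u1)).
set al := (X in drift_jet _ _ _ _ X _); set l := (X in drift_jet _ _ _ _ _ X).
move=> jet_psi; exists (al, l).
  by move: jet_psi; congr drift_jet; apply/funext => w; rewrite mulNr.
rewrite /= /l; set S := \sum_(i < n) _.
have frob_le : frob (E *m T) <= frob T by case: fr => EE _ _; exact: frob_bessel.
have frob0 : 0 <= frob (E *m T) by exact: frob_ge0.
have L_le q' : `|D q' u| <= C1 -> `|L q'| <= C0.
  by rewrite /L /C0 !ler_norml => /andP[? ?]; apply/andP; split; lra.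
have S_ge : kappa <= S.
  have := frame_gradient_bound T q v fr.
  have -> : \sum_(i < n) (2 * dot (F u *m T - q) (row i (E *m T))) ^+ 2 = S.
    by apply: eq_bigr => i _; rewrite expr2.
  rewrite -/(h u) -/(M u) => grad.
  have S0 : 0 <= S by apply: sumr_ge0 => i _; rewrite -expr2 sqr_ge0.
  rewrite /kappa ler_pdivrMr //.
  have : M u * S <= A * S by rewrite ler_wpM2r.
  have : (p0 / 2) ^+ 2 <= h u ^+ 2.
    by rewrite ler_pXn2r // nnegrE ?(le_trans _ h_ge) // divr_ge0 // ltW.
  rewrite expr_div_n; move: grad; lra.
have := L_le _ D1; have := L_le _ D2.
rewrite !ler_norml => /andP[_ Lt_le] /andP[Lge Lle].
have : 2 * beta * kappa <= 2 * beta * S by rewrite ler_wpM2l // mulr_ge0 // ltW.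
rewrite betaE.
(* L of the barrier is (1 - 2 beta sigma) L sigma - 2 beta |grad sigma|^2 + L tau,
   at most 2 C0 - (3 C0 + 1) + C0. *)
have : L q * (1 - 2 * (beta * sigma u)) <= C0 * 2.
  move: small_s; rewrite ler_norml => /andP[s1 s2].
  apply: (@le_trans _ _ (C0 * (1 - 2 * (beta * sigma u)))).
    by apply: ler_wpM2r => //; lra.
  by apply: ler_wpM2l => //; lra.
move: Lt_le; lra.
Unshelve. all: by end_near. Qed.

End StrongMaximumPrinciple.

(** * The strong maximum principle *)

Section ZeroSetOpen.
Context {R : realType} {n m : nat}.
Variables (F : 'rV[R]_n -> 'rV[R]_m) (U : set 'rV[R]_n).
Hypothesis oU : open U.
Hypothesis dF : forall u, U u -> differentiable F u.
Hypothesis ddF : forall u, U u -> forall v, differentiable ('D_v F) u.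
Variable w : 'rV[R]_n -> R.
Hypothesis w_ge0 : forall u, U u -> 0 <= w u.
Hypothesis cw : forall u, U u -> {for u, continuous w}.

Section Touching.
Variables (u0 : 'rV[R]_n) (T : 'M[R]_(m, n)) (r : R).
Hypothesis r_gt0 : 0 < r.
Hypothesis straightT : forall u : 'rV[R]_n, `|u0 - u| <= r ->
  U u /\ forall v, `|'D_v F u *m T - v| <= 2^-1 * `|v|.
Local Notation G := (fun u => F u *m T).

(** Among the zeros of [w] in the box, take one, [u1], closest to a point [y]
    outside the zero set. As [y] is taken much closer to [u0] than to the
    boundary of the box, [u1] is interior. *)
Lemma interior_touching : w u0 = 0 -> ~ (\forall u \near u0, w u = 0) ->
  exists y u1 : 'rV[R]_n, [/\ `|u0 - y| <= r, `|u0 - u1| < r, 0 < w y, w u1 = 0 &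
    forall u : 'rV[R]_n, `|u0 - u| <= r -> w u = 0 ->
      sqdist F T (G y) u1 <= sqdist F T (G y) u].
Proof.
move=> w0 not_near.
have K0 : `|u0 - u0| <= r by rewrite subrr normr0 ltW.
have Uu0 : U u0 by have [] := straightT K0.
pose d := r / 4; have d0 : 0 < d by rewrite divr_gt0.
have [y [yK wy Gy]] : exists y : 'rV[R]_n,
    [/\ `|u0 - y| <= d, w y != 0 & sqdist F T (G u0) y <= d ^+ 2].
  apply: contra_notP not_near => /forallNP no.
  have near_y : \forall y \near u0, `|u0 - y| <= d.
    apply/nbhs_ballP; exists d => // z; rewrite -ball_normE /ball_ /=; exact: ltW.
  have near_G : \forall y \near u0, sqdist F T (G u0) y <= d ^+ 2.
    apply: near_le.
      by apply: continuous_sqdist; exact: (entries_continuousF dF).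
    by rewrite /sqdist subrr dotE mul0mx mxE exprn_gt0.
  near=> y; have yd : `|u0 - y| <= d by near: y.
  have yG : sqdist F T (G u0) y <= d ^+ 2 by near: y.
  by apply: contrapT => /eqP wy; apply: (no y).
have yr : `|u0 - y| <= r by rewrite (le_trans yK) // /d; move: (r_gt0); lra.
have Uy : U y by have [] := straightT yr.
pose K := closed_ball_ Num.Def.normr u0 r.
have [u1 [u1K u1w] u1min] : exists2 u1, (K `&` w @^-1` [set 0]) u1 &
    forall u, (K `&` w @^-1` [set 0]) u ->
      sqdist F T (G y) u1 <= sqdist F T (G y) u.
  apply: compact_min.
  - by exists u0.
  - apply: compact_preimageI; first exact: closed_box_compact.
      by move=> x xK; apply: cw; have [] := straightT xK.
    exact: closed_eq.
  - move=> x [xK _]; apply: continuous_sqdist; apply: (entries_continuousF dF).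
    by have [] := straightT xK.
exists y, u1; split=> //; last by move=> u uK wu; apply: u1min.
  have Gu1 : `|G u1 - G y| <= d.
    apply: norm_le_dot; first exact: ltW.
    apply: le_trans (u1min u0 _) _; first by split.
    rewrite /sqdist -(opprB (G y)); move: Gy; rewrite /sqdist.
    by rewrite !dotE linearN /= mulNmx mulmxN opprK.
  have := straightened_expansive dF straightT u1K yr.
  have := ler_distD y u0 u1; rewrite (distrC y u1).
  move: Gu1 yK (r_gt0); rewrite /d; lra.
by rewrite lt_def wy w_ge0.
Unshelve. all: by end_near. Qed.

End Touching.

Hypothesis supersolution : forall u, U u ->
  forall e b (E : 'M[R]_(n, m)), shrinker_frame F u e b E ->
  exists2 al : ('I_n -> R) * R, drift_jet u e b w al.1 al.2 & al.2 <= 0.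
Hypothesis frames : forall u, U u ->
  exists (e : 'I_n -> 'rV[R]_n) (b : 'rV[R]_n) (E : 'M[R]_(n, m)),
    shrinker_frame F u e b E.
Hypothesis injF : forall u, U u -> injective ('d F u).

(** The strong maximum principle. At the touching point [u1], [w] plus a small
    multiple of the barrier vanishes, and it is positive on the boundary of a
    small box; so it has an interior minimum, where L of it would be both
    nonnegative and negative. *)
Lemma zero_set_open u0 : U u0 -> w u0 = 0 -> \forall u \near u0, w u = 0.
Proof.
move=> Uu0 wu0.
have [T [r [r0 straightT]]] := local_straightening oU dF ddF Uu0 (injF Uu0).
apply: contrapT => not_near.
have [y [u1 [yK u1K wy wu1 touch]]] :=
  interior_touching r0 straightT wu0 not_near.
have u1y : u1 != y by apply: contraTneq wy => <-; rewrite wu1 ltxx.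
have /= [beta [rho [rho0 barrier]]] := hopf_barrier dF ddF straightT yK u1K u1y.
set q := F y *m T in touch barrier.
pose sigma u := sqdist F T q u - sqdist F T q u1.
pose tau u := sqdist F T (F u1 *m T) u.
pose psi u := sigma u - beta * (sigma u * sigma u) + tau u.
pose N : set 'rV[R]_n := closed_ball_ Num.Def.normr u1 rho.
have N_K u : N u -> `|u0 - u| <= r by move=> /barrier[].
have N_U u : N u -> U u by move=> /N_K/straightT[].
have c_sq q' u : N u -> {for u, continuous (sqdist F T q')}.
  by move=> Nu; apply: continuous_sqdist; apply: (entries_continuousF dF); exact: N_U.
have c_psi u : N u -> {for u, continuous psi}.
  move=> Nu; have c_sigma : {for u, continuous sigma}.
    by apply: continuousB; [exact: c_sq|exact: cst_continuous].
  apply: continuousD; last exact: c_sq.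
  apply: continuousB => //; apply: continuousM; first exact: cst_continuous.
  exact: continuousM.
have c_w u : N u -> {for u, continuous w} by move=> /N_U; exact: cw.
have N1 : N u1 by rewrite /N /closed_ball_ /= subrr normr0 ltW.
have tau_gt0 u : N u -> `|u1 - u| = rho -> 0 < tau u.
  move=> Nu urho; rewrite lt_def dot_ge0 andbT; apply/eqP => tau0.
  have := sqdist_eq0 dF straightT (N_K _ Nu) (N_K _ N1) tau0.
  by move=> uu1; move: urho rho0; rewrite uu1 subrr normr0 => <-; rewrite ltxx.
(* Outside the touching ball the barrier is positive by itself; on the part
   of the boundary where it is not, [w] is positive. *)
have w_pos u : N u -> `|u1 - u| = rho -> psi u <= 0 -> 0 < w u.
  move=> Nu urho psi_le; rewrite lt_def w_ge0 ?andbT; last exact: N_U.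
  apply/eqP => wu.
  have s_ge0 : 0 <= sigma u by rewrite subr_ge0 touch //; exact: N_K.
  have [_ small _] := barrier u Nu; rewrite -/(sigma u) in small.
  have := tau_gt0 u Nu urho.
  move: psi_le; rewrite /psi.
  have : (beta * sigma u) * sigma u <= 2^-1 * sigma u.
    by apply: ler_wpM2r => //; apply: le_trans small; exact: ler_norm.
  lra.
have [eps eps0 bdry] : exists2 eps : R, 0 < eps &
    forall u, N u -> `|u1 - u| = rho -> 0 < w u + eps * psi u.
  pose C := (N `&` (fun u => `|u1 - u|) @^-1` [set rho]) `&`
    psi @^-1` [set x | x <= 0].
  have cC : compact C.
    apply: compact_preimageI; last exact: closed_le.
      apply: compact_preimageI; first exact: closed_box_compact.
        by move=> u _; exact: continuous_dist.
      exact: closed_eq.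
    by move=> u [Nu _]; exact: c_psi.
  have [C0|C0] := pselect (C !=set0); last first.
    exists 1 => // u Nu urho; rewrite mul1r ltr_wpDl ?w_ge0 //; first exact: N_U.
    by rewrite ltNge; apply/negP => psi_le; apply: C0; exists u.
  have [|c [[Nc crho] cpsi] minw] := compact_min C0 cC (f := w).
    by move=> u [[Nu _] _]; exact: c_w.
  have [|c' [[Nc' crho'] cpsi'] minpsi] := compact_min C0 cC (f := psi).
    by move=> u [[Nu _] _]; exact: c_psi.
  have wc := w_pos c Nc crho cpsi.
  pose eps := w c / (1 - psi c').
  have den : 0 < 1 - psi c' by move: cpsi' => /=; lra.
  have eps0 : 0 < eps by exact: divr_gt0.
  exists eps => // u Nu urho; have [psi_le|psi_gt] := leP (psi u) 0.
    have Cu : C u by [].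
    have : eps * psi c' <= eps * psi u by rewrite ler_pM2l //; exact: minpsi.
    have : eps * (1 - psi c') = w c by rewrite divfK // gt_eqF.
    have := minw u Cu; move: eps0; lra.
  by apply: ltr_wpDl; [apply/w_ge0/N_U|exact: mulr_gt0].
pose f u := w u + eps * psi u.
have [| | |u2 Nu2 f_min] := compact_min (A := N) (f := f).
- by exists u1.
- exact: closed_box_compact.
- move=> u Nu; apply: continuousD; first exact: c_w.
  by apply: continuousM; [exact: cst_continuous|exact: c_psi].
have f_u1 : f u1 = 0.
  rewrite /f wu1 /psi /sigma /tau /sqdist !subrr dotE mul0mx mxE.
  by rewrite !(mulr0, addr0, subr0).
have u2_lt : `|u1 - u2| < rho.
  rewrite lt_neqAle Nu2 andbT; apply/eqP => u2rho.
  by have := bdry u2 Nu2 u2rho; rewrite ltNge -f_u1 f_min.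
have f_loc : \forall u \near u2, f u2 <= f u.
  apply/nbhs_ballP; exists (rho - `|u1 - u2|); first by rewrite /= subr_gt0.
  move=> z; rewrite -ball_normE /ball_ /= => zu2; apply: f_min.
  rewrite /N /closed_ball_ /= -[u1](subrK u2) -addrA.
  by rewrite (le_trans (ler_normD _ _)) // -lerBrDl ltW.
have [e [b [E fr]]] := frames (N_U _ Nu2).
have [[a1 l1] /= jw l1_le] := supersolution (N_U _ Nu2) fr.
have [_ _ /(_ e b E fr)[[a2 l2] /= jpsi l2_lt]] := barrier u2 Nu2.
have := drift_jet_min (drift_jetD jw (drift_jetZ eps jpsi)) f_loc.
by rewrite leNgt ltr_wnDl // pmulr_rlt0.
Qed.

End ZeroSetOpen.

(** * The global argument *)

Section ShrinkerLaplacian.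
Context {R : realType} {V : normedModType R} {n k p : nat}.
Variables (F : V -> 'rV[R]_(k.+1 + p)) (u : V) (e : 'I_n -> V) (b : V).
Variable E : 'M[R]_(n, k.+1 + p).
Hypothesis fr : shrinker_frame F u e b E.

(** Right multiplication by it is the projection of R^(k+1) x R^p onto R^(k+1). *)
Definition ball_proj : 'M[R]_(k.+1 + p, k.+1) := col_mx 1%:M 0.

Lemma mul_row_ball_proj (x : 'rV[R]_k.+1) (y : 'rV[R]_p) :
  row_mx x y *m ball_proj = x.
Proof. by rewrite mul_row_col mulmx1 mulmx0 addr0. Qed.

Lemma frob_frame : frob E = n%:R.
Proof. by case: fr => EE _ _; rewrite /frob EE mxtrace1. Qed.

(** The frame has total squared length [n], of which the [p] coordinates of the
    axis can carry at most [p], by Bessel's inequality. *)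
Lemma frob_frame_ball_proj : n%:R - p%:R <= frob (E *m ball_proj).
Proof.
pose Z : 'M[R]_(k.+1 + p, p) := col_mx 0 1%:M.
have split_E : frob E = frob (E *m ball_proj) + frob (E *m Z).
  rewrite /frob -raddfD /= -[E]hsubmxK !mul_row_col !mulmx1 !mulmx0 addr0 add0r.
  by rewrite tr_row_mx mul_row_col.
have frob_Z : frob Z = p%:R.
  rewrite /frob mxtrace_mulC tr_col_mx mul_row_col trmx0 mul0mx add0r.
  by rewrite trmx1 mulmx1 mxtrace1.
have : frob (E *m Z) <= frob Z by case: fr => EE _ _; exact: frob_bessel.
move: split_E; rewrite frob_Z frob_frame; lra.
Qed.

Lemma shrinker_laplacian_norm2 :
  exists a, drift_jet u e b (sqdist F 1%:M 0) a (2 * n%:R - sqdist F 1%:M 0 u).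
Proof.
exists (fun i => 2 * dot (F u *m 1%:M - 0) (row i (E *m 1%:M))).
have := drift_jet_sqdist 1%:M 0 fr; congr drift_jet.
by rewrite /sqdist !mulmx1 frob_frame !subr0.
Qed.

(** With Y the component in R^(k+1), L |Y|^2 >= 2 (n - p) - |Y|^2: this is where
    the value of the radius comes from. *)
Lemma shrinker_laplacian_ball (r : R) : r ^+ 2 = 2 * (n%:R - p%:R) ->
  exists2 al : ('I_n -> R) * R,
    drift_jet u e b (fun w => r ^+ 2 - sqdist F ball_proj 0 w) al.1 al.2 &
    al.2 <= - (r ^+ 2 - sqdist F ball_proj 0 u).
Proof.
move=> r2.
have := drift_jetD (drift_jet_cst u e b (r ^+ 2))
  (drift_jetZ (- 1) (drift_jet_sqdist ball_proj 0 fr)).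
set a := (X in drift_jet _ _ _ _ X _); set l := (X in drift_jet _ _ _ _ _ X).
move=> j; exists (a, l).
  by move: j; congr drift_jet; apply/funext => w; rewrite mulN1r.
have := frob_frame_ball_proj; rewrite /l /sqdist !subr0 r2 /=; lra.
Qed.

End ShrinkerLaplacian.

Section Global.
Context {R : realType} {n k p : nat} {M : topologicalType}.
Variables (S : smooth_manifold R n M) (X : M -> 'rV[R]_(k.+1 + p)) (r : R).
Hypothesis immX : immersion S X.
Hypothesis shrX : self_shrinker S X.
Hypothesis properX : proper_map X.
Hypothesis r2 : r ^+ 2 = 2 * (n%:R - p%:R).
Hypothesis n_gt0 : (0 < n)%N.

Let w x := r ^+ 2 - dot (X x *m ball_proj) (X x *m ball_proj).
Let h x := dot (X x) (X x).
Hypothesis w_ge0 : forall x, 0 <= w x.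

Section InChart.
Variable c : chart R n M.
Hypothesis ac : atlas S c.
Let F := X \o param c.
Let U := img c.

Lemma chart_diff u : U u -> differentiable F u.
Proof. by have [/(_ 1%N)[dF _] _] := immX ac; exact: dF. Qed.

Lemma chart_diff2 u : U u -> forall v, differentiable ('D_v F) u.
Proof. by have [/(_ 2%N)[_ ddF] _] := immX ac => Uu v; have [d _] := ddF v; exact: d. Qed.

Lemma chart_frame u : U u ->
  exists (e : 'I_n -> 'rV[R]_n) (b : 'rV[R]_n) (E : 'M[R]_(n, k.+1 + p)),
    shrinker_frame F u e b E.
Proof.
move=> Uu; apply: shrinker_frame_exists.
- have : nbhs u U by apply: open_nbhs_nbhs; split=> //; exact: img_open.
  by apply: filterS => z; exact: chart_diff.
- by move=> v; exact: chart_diff2.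
- exact: (shrX ac Uu).
Qed.

Lemma chart_gap u : w (param c u) = r ^+ 2 - sqdist F ball_proj 0 u.
Proof. by rewrite /sqdist subr0. Qed.

Lemma chart_norm2 u : h (param c u) = sqdist F 1%:M 0 u.
Proof. by rewrite /sqdist mulmx1 subr0. Qed.

Lemma chart_gap_continuous u : U u -> {for u, continuous (w \o param c)}.
Proof.
move=> Uu; have -> : w \o param c = fun u => r ^+ 2 - sqdist F ball_proj 0 u.
  by apply/funext => z /=; rewrite chart_gap.
apply: continuousB; first exact: cst_continuous.
by apply: continuous_sqdist; apply: (entries_continuousF chart_diff).
Qed.

Lemma chart_zero_open u : U u -> w (param c u) = 0 ->
  \forall z \near u, w (param c z) = 0.
Proof.
apply: (@zero_set_open _ _ _ F U) => //.
- exact: img_open.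
- exact: chart_diff.
- exact: chart_diff2.
- exact: chart_gap_continuous.
- move=> z Uz e b E fr; have [al j l_le] := shrinker_laplacian_ball fr r2.
  exists al.
    by move: j; congr drift_jet; apply/funext => y; rewrite /= chart_gap.
  by rewrite (le_trans l_le) // oppr_le0 -chart_gap.
- exact: chart_frame.
- by have [_ i] := immX ac => z Uz; exact: i.
Qed.

(** At a local minimum of w + eps |X|^2, the second-derivative test reads
    0 <= - w + eps (2 n - |X|^2). *)
Lemma chart_min u (eps : R) : 0 < eps -> U u ->
  (\forall z \near u, w (param c u) + eps * h (param c u) <=
                      w (param c z) + eps * h (param c z)) ->
  w (param c u) + eps * h (param c u) <= eps * (2 * n%:R).
Proof.
move=> eps0 Uu fmin; have [e [b [E fr]]] := chart_frame Uu.
have [[a l] /= jw l_le] := shrinker_laplacian_ball fr r2.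
have [a' jh] := shrinker_laplacian_norm2 fr.
pose f z := r ^+ 2 - sqdist F ball_proj 0 z + eps * sqdist F 1%:M 0 z.
have f_min : \forall z \near u, f u <= f z.
  by apply: filterS fmin => z; rewrite !chart_gap !chart_norm2.
have := drift_jet_min (drift_jetD jw (drift_jetZ eps jh)) f_min.
by rewrite chart_gap chart_norm2 mulrBr; move: l_le; lra.
Qed.

End InChart.

Lemma near_chart x (P : M -> Prop) c : atlas S c -> dom c x ->
  (\forall z \near coords c x, P (param c z)) -> \forall y \near x, P y.
Proof.
move=> ac dx nP.
have near_dom : \forall y \near x, dom c y.
  by apply: open_nbhs_nbhs; split=> //; exact: dom_open.
have near_P : \forall y \near x, P (param c (coords c y)).
  exact: (coords_continuous_on dx nP).
by near=> y; rewrite -(@coordsK _ _ _ c y); near: y.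
Unshelve. all: by end_near. Qed.

Lemma near_param x (P : M -> Prop) c : atlas S c -> dom c x ->
  (\forall y \near x, P y) -> \forall z \near coords c x, P (param c z).
Proof.
move=> ac dx nP.
have nP' : nbhs (param c (coords c x)) P by rewrite coordsK.
exact: (param_continuous_on (coords_img dx) nP').
Qed.

Lemma continuous_gap x : {for x, continuous w}.
Proof.
have [c ac dx] := atlas_cover S x.
move=> A nA; apply: (near_chart ac dx).
have := chart_gap_continuous ac (coords_img dx).
by move=> /(_ A); rewrite /= coordsK //; exact.
Qed.

Lemma continuous_norm2 x : {for x, continuous h}.
Proof.
have [c ac dx] := atlas_cover S x.
move=> A nA; apply: (near_chart ac dx).
have : {for coords c x, continuous (h \o param c)}.
  have -> : h \o param c = sqdist (X \o param c) 1%:M 0.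
    by apply/funext => z /=; rewrite chart_norm2.
  apply: continuous_sqdist; apply: (entries_continuousF (chart_diff ac)).
  exact: coords_img.
by move=> /(_ A); rewrite /= coordsK //; exact.
Qed.

Let B : set M := [set x | 0 < w x].

Lemma positive_open : open B.
Proof.
rewrite openE => x Bx.
exact: (continuous_gap (open_nbhs_nbhs (conj (@open_gt R 0) Bx))).
Qed.

(** The complement, the zero set of [w], is open by the strong maximum
    principle. Having [B] both open and closed lets one minimise over [B]
    without speaking of connected components. *)
Lemma positive_closed : closed B.
Proof.
have -> : B = ~` [set x | w x = 0].
  apply/seteqP; split=> x; rewrite /B /=; first by move=> w0 w0'; rewrite w0' ltxx in w0.
  by move=> w0; rewrite lt_def w_ge0 andbT; apply/eqP.
apply: open_closedC; rewrite openE => x /= wx.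
have [c ac dx] := atlas_cover S x.
apply: (near_chart ac dx); apply: (chart_zero_open ac (coords_img dx)).
by rewrite coordsK.
Qed.

Lemma positive_box_compact (rho : R) : compact (X @^-1` closed_ball_ Num.Def.normr 0 rho `&` B).
Proof.
apply: compact_closedI; last exact: positive_closed.
by apply: properX; exact: closed_box_compact.
Qed.

Lemma box_of_norm2 x (rho : R) : 0 <= rho -> h x <= rho ^+ 2 ->
  (X @^-1` closed_ball_ Num.Def.normr 0 rho) x.
Proof.
by move=> rho0 hx; rewrite /closed_ball_ /= sub0r normrN; exact: norm_le_dot.
Qed.

(** The function w + eps |X|^2 is proper, so it attains its minimum on the closed
    set [B], and this is a local minimum because [B] is open. *)
Lemma positive_small_point x0 (eps : R) : B x0 -> 0 < eps ->
  exists x, [/\ B x, h x <= 2 * n%:R & w x <= eps * (2 * n%:R)].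
Proof.
move=> Bx0 eps0; pose f x := w x + eps * h x.
pose rho := f x0 / eps + 1.
have h_ge0 x : 0 <= h x by exact: dot_ge0.
have eps_ge0 := ltW eps0.
have f0 : 0 <= f x0 / eps by rewrite divr_ge0 // addr_ge0 // mulr_ge0.
have rho_le : f x0 / eps <= rho ^+ 2.
  rewrite /rho expr2; move: f0; set t := f x0 / eps; nra.
have rho0 : 0 <= rho by rewrite addr_ge0.
have big_f x : ~ (X @^-1` closed_ball_ Num.Def.normr 0 rho) x -> f x0 <= f x.
  move=> out; have : rho ^+ 2 <= h x.
    by rewrite leNgt; apply/negP => hx; apply: out; apply: box_of_norm2 => //; exact: ltW.
  move=> /(le_trans rho_le); rewrite ler_pdivrMr // mulrC => /le_trans; apply.
  by rewrite /f lerDr.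
have [|||x [xbox Bx] xmin] := compact_min
  (A := X @^-1` closed_ball_ Num.Def.normr 0 rho `&` B) (f := f).
- exists x0; split=> //; apply: box_of_norm2 => //.
  by apply: le_trans rho_le; rewrite ler_pdivlMr // mulrC lerDr.
- exact: positive_box_compact.
- move=> x _; apply: continuousD; first exact: continuous_gap.
  by apply: continuousM; [exact: cst_continuous|exact: continuous_norm2].
have x0box : (X @^-1` closed_ball_ Num.Def.normr 0 rho) x0.
  apply: box_of_norm2 => //.
  by apply: le_trans rho_le; rewrite ler_pdivlMr // mulrC lerDr.
have x_near : \forall y \near x, f x <= f y.
  have : \forall y \near x, B y by apply: open_nbhs_nbhs; split=> //; exact: positive_open.
  apply: filterS => y By.
  have [ybox|/big_f] := pselect ((X @^-1` closed_ball_ Num.Def.normr 0 rho) y).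
    exact: xmin.
  by apply: le_trans; exact: xmin.
have [c ac dx] := atlas_cover S x.
have := chart_min ac eps0 (coords_img dx).
rewrite coordsK // => /(_ (near_param ac dx x_near)) bound.
exists x; split=> //.
  rewrite -(ler_pM2l eps0); have := w_ge0 x; move: bound; lra.
have : 0 <= eps * h x by rewrite mulr_ge0 // ltW.
move: bound; lra.
Qed.

(** The points of the previous lemma stay in a compact part of [B] as eps tends
    to 0, while [w] has a positive minimum there. *)
Lemma gap_eq0 x : w x = 0.
Proof.
apply/eqP; rewrite eq_le w_ge0 andbT leNgt; apply/negP => Bx.
pose N : R := 2 * n%:R; have N0 : 0 < N by rewrite mulr_gt0 // ltr0n.
have inbox y : h y <= N -> (X @^-1` closed_ball_ Num.Def.normr 0 (N + 1)) y.
  by move=> hy; apply: box_of_norm2; [move: N0; lra|rewrite (le_trans hy) // expr2; nra].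
have [x1 [B1 h1 _]] := positive_small_point Bx ltr01.
have [|||y [ybox By] ymin] := compact_min
  (A := X @^-1` closed_ball_ Num.Def.normr 0 (N + 1) `&` B) (f := w).
- by exists x1; split=> //; exact: inbox.
- exact: positive_box_compact.
- by move=> z _; exact: continuous_gap.
have eps0 : 0 < w y / (2 * N) by rewrite divr_gt0 // mulr_gt0.
have [z [Bz hz wz]] := positive_small_point Bx eps0.
have := ymin z (conj (inbox z hz) Bz).
have : w y / (2 * N) * N = w y / 2 by field; rewrite gt_eqF.
move: wz (By : 0 < w y); rewrite -/N; lra.
Qed.

End Global.

Lemma closure_eball_dot (R : realType) d (r : R) (a : 'rV[R]_d) : 0 <= r ->
  closure (eball r) a -> dot a a <= r ^+ 2.
Proof.
move=> r0; have cl : closed [set v : 'rV[R]_d | dot v v <= r ^+ 2].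
  apply: (preimage_closed (f := fun v => dot v v) (D := [set x | x <= r ^+ 2])).
    move=> v _; apply: continuous_dot;
      by apply: (entries_continuous_of (f := id)) => B.
  exact: closed_le.
move=> ca; apply: cl; apply: closureS ca => v; rewrite /eball /enorm /= => vr.
by rewrite -[dot v v]sqr_sqrtr ?dot_ge0 // ler_pXn2r ?nnegrE ?sqrtr_ge0 // ltW.
Qed.

Theorem theorem13 (R : realType) (n k p : nat) (M : topologicalType)
    (S : smooth_manifold R n M) (X : M -> 'rV[R]_(k.+1 + p)) :
  let m := (k.+1 + p)%N in
  let r := Num.sqrt (2 * (n%:R - p%:R)) : R in
  (n < m)%N ->
  (m - n <= k)%N -> (k + 2 <= m)%N ->
  immersion S X ->
  complete_immersion S X ->
  self_shrinker S X ->
  proper_map X ->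
  range X `<=` cylinder (closure (eball r)) ->
  range X `<=` cylinder (esphere r).
Proof.
move=> m r n_lt_m mn_le_k _ immX _ shrX properX inside.
have p_lt_n : (p < n)%N.
  by move: mn_le_k; rewrite leq_subLR /m addSn -addnS addnC leq_add2r.
have r2 : r ^+ 2 = 2 * (n%:R - p%:R).
  by rewrite sqr_sqrtr // mulr_ge0 // subr_ge0 ler_nat ltnW.
have r0 : 0 <= r by exact: sqrtr_ge0.
have w_ge0 x : 0 <= r ^+ 2 - dot (X x *m ball_proj) (X x *m ball_proj).
  have [a ca [b _ <-]] := inside _ (imageT X x).
  by rewrite mul_row_ball_proj subr_ge0; exact: closure_eball_dot.
move=> _ [x _ <-].
have [a ca [b _ Xx]] := inside _ (imageT X x).
exists a; last by exists b.
have n_gt0 := leq_ltn_trans (leq0n p) p_lt_n.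
have := gap_eq0 immX shrX properX r2 n_gt0 w_ge0 x.
rewrite -Xx mul_row_ball_proj => /eqP; rewrite subr_eq0 => /eqP r2a.
by rewrite /esphere /enorm /= -r2a sqrtr_sqr ger0_norm.
Qed.
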